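(* Let $0<\alpha<1$. For any $\beta\in(0,1-\alpha)$ there exists a constant $C_0(\alpha,\beta)$, independent of $d$, such that asymptotically the maximum type II error of the test based on $\hat\zeta_{n,\sigma}$ over $\mathcal F(cn^{-1})$ is bounded above by $\beta$ for all $c>C_0(\alpha,\beta)$, i.e. $$\limsup_{n\to\infty}\ \sup_{F\in\mathcal F(cn^{-1})}\mathbb P_{F^n}\big(\hat\zeta_{n,\sigma}\le\hat c_{1-\alpha}\big)\le\beta\qquad\text{for all }c>C_0(\alpha,\beta).$$
   Context: Fix $\sigma^2>0$, $K(\mathbf x,\mathbf y)=\exp\{-\sigma^2\|\mathbf x-\mathbf y\|^2/2\}$ on $\mathbb R^d$, $d=d_X+d_Y+d_Z$. For a distribution $\mathrm P$ of $(\mathbf X,\mathbf Y,\mathbf Z)$ on $\mathbb R^d$, let $\mathbf V_i=(\mathbf X_i,\mathbf Y_i,\mathbf Z_i)$ be i.i.d. from $\mathrm P$ and, given these, draw $\mathbf X_i'\sim\mathrm P_{\mathbf X\mid\mathbf Z_i}$ independently (so $\mathbf X_i'$ is conditionally independent of $(\mathbf X_i,\mathbf Y_i)$ given $\mathbf Z_i$); $\mathbf V_i'=(\mathbf X_i',\mathbf Y_i,\mathbf Z_i)$. Put $\zeta_\sigma(\mathrm P)=\mathbb E[K(\mathbf V_1,\mathbf V_2)]+\mathbb E[K(\mathbf V_1',\mathbf V_2')]-2\mathbb E[K(\mathbf V_1,\mathbf V_2')]$, $\mathcal F(\epsilon)=\{\mathrm P:\zeta_\sigma(\mathrm P)>\epsilon\}$,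 and $$\hat\zeta_{n,\sigma}=\binom n2^{-1}\sum_{1\le i<j\le n}\big\{K(\mathbf V_i,\mathbf V_j)+K(\mathbf V_i',\mathbf V_j')-K(\mathbf V_i,\mathbf V_j')-K(\mathbf V_i',\mathbf V_j)\big\}.$$ For $\pi\in\{0,1\}^n$, $\hat\zeta_{n,\sigma}(\pi)$ is the same statistic with $(\mathbf X_i,\mathbf X_i')$ replaced by $(\mathbf U_i,\mathbf U_i')$, $\mathbf U_i=\pi(i)\mathbf X_i+(1-\pi(i))\mathbf X_i'$, $\mathbf U_i'=(1-\pi(i))\mathbf X_i+\pi(i)\mathbf X_i'$, and $$\hat c_{1-\alpha}=\inf\Big\{t\in\mathbb R:2^{-n}\sum_{\pi\in\{0,1\}^n}\mathrm I[\hat\zeta_{n,\sigma}(\pi)\le t]\ge1-\alpha\Big\}.$$ The test rejects when $\hat\zeta_{n,\sigma}>\hat c_{1-\alpha}$. $\mathbb P_{F^n}$ is the probability under the joint distribution of the augmented data $\{(\mathbf X_i,\mathbf X_i',\mathbf Y_i,\mathbf Z_i)\}_{i=1}^n$ when $(\mathbf X_i,\mathbf Y_i,\mathbf Z_i)$ are i.i.d. from $F$. *)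

(* Defs.v *)
From HB Require Import structures.
From mathcomp Require Import all_boot all_order all_algebra.
From mathcomp Require Import all_classical all_reals all_analysis measurable_realfun.

Set Implicit Arguments.
Unset Strict Implicit.
Unset Printing Implicit Defensive.
Import Order.TTheory GRing.Theory Num.Theory.

Local Open Scope classical_set_scope.
Local Open Scope ring_scope.

(* Law of (V, X') when V ~ F and, given V, X' ~ k V.2. *)
Section extend_law.
Context {d d1 d2 : measure_display} {W : measurableType d}
  {Z : measurableType d1} {X : measurableType d2} {R : realType}.
Local Open Scope ereal_scope.

Variables (F : probability (W * Z)%type R) (k : R.-pker Z ~> X).

Definition extend_law (A : set (W * Z * X)) : \bar R :=
  \int[F]_v k v.2 (xsection A v).

Let k_snd (v : W * Z) : {measure set X -> \bar R} := k v.2.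

Let measurable_k_snd (U : set X) : measurable U ->
  measurable_fun [set: W * Z] (k_snd ^~ U).
Proof.
move=> mU; apply: (@measurableT_comp _ _ _ _ _ _ (k ^~ U)) => //.
exact: measurable_kernel.
Qed.

HB.instance Definition _ := isKernel.Build _ _ _ _ _ k_snd measurable_k_snd.

Let k_snd_setT v : k_snd v setT = 1.
Proof. exact: prob_kernel. Qed.

HB.instance Definition _ :=
  Kernel_isProbability.Build _ _ _ _ _ k_snd k_snd_setT.

Let measurable_section (A : set (W * Z * X)) : measurable A ->
  measurable_fun [set: W * Z] (fun v => k v.2 (xsection A v)).
Proof.
move=> mA; apply: (@measurable_fun_xsection_finite_kernel _ _ _ _ _ k_snd).
by rewrite inE.
Qed.

Let extend_law0 : extend_law set0 = 0.
Proof. by apply: integral0_eq => v _; rewrite xsection0 measure0. Qed.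

Let extend_law_ge0 A : 0 <= extend_law A.
Proof. exact: integral_ge0. Qed.

Let extend_law_sigma_additive : semi_sigma_additive extend_law.
Proof.
move=> A mA tA mUA.
rewrite [X in _ --> X](_ : _ = \sum_(n <oo) extend_law (A n)).
  by apply/cvg_closeP; split; [exact: is_cvg_nneseries|rewrite closeE].
rewrite -integral_nneseries//; last by move=> n; exact: measurable_section.
apply: eq_integral => v _; apply/esym/cvg_lim => //=; rewrite xsection_bigcup.
apply: (measure_sigma_additive _ (trivIset_xsection tA)) => ?.
exact: measurable_xsection.
Qed.

HB.instance Definition _ := isMeasure.Build _ _ _ extend_law
  extend_law0 extend_law_ge0 extend_law_sigma_additive.

Let extend_law_setT : extend_law setT = 1.
Proof.
rewrite /extend_law; under eq_integral.
  move=> v _; rewrite (_ : xsection _ _ = setT) ?prob_kernel; first over.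
  by apply/seteqP; split => // x _; rewrite /xsection /= inE.
by rewrite integral_cst// mul1e; exact: probability_setT.
Qed.

HB.instance Definition _ :=
  Measure_isProbability.Build _ _ _ extend_law extend_law_setT.

End extend_law.

(* P^n, the law of n independent draws from P. *)
Section iid_law.
Context {d : measure_display} {T : measurableType d} {R : realType}.
Local Open Scope ereal_scope.

Definition cons_pair (n : nat) (p : T * n.-tuple T) : n.+1.-tuple T :=
  [the n.+1.-tuple T of p.1 :: p.2].

Let measurable_cons_pair n : measurable_fun setT (@cons_pair n).
Proof. exact: measurable_cons. Qed.

HB.instance Definition _ n := isMeasurableFun.Build _ _ _ _
  (@cons_pair n) (@measurable_cons_pair n).

Fixpoint iid_law (P : probability T R) (n : nat) : probability (n.-tuple T) R :=
  if n is m.+1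
  then distribution (P \x iid_law P m) (@cons_pair m)
  else \d_([tuple] : 0.-tuple T).

Lemma iid_law_rect (P : probability T R) n (A : 'I_n -> set T) :
  (forall i, measurable (A i)) ->
  iid_law P n [set t | forall i, A i (tnth t i)] = \prod_(i < n) P (A i).
Proof.
elim: n A => [|n IH] A mA.
  rewrite big_ord0 /= diracE mem_set//.
  by move=> [].
rewrite big_ord_recl -(IH (fun i => A (lift ord0 i)))// /= /distribution.
have mB : measurable [set t : n.-tuple T | forall i, A (lift ord0 i) (tnth t i)].
  rewrite (_ : [set t | _] =
    \big[setI/setT]_(i < n) ((fun t : n.-tuple T => tnth t i) @^-1` A (lift ord0 i))).
    apply: bigsetI_measurable => i _; rewrite -[X in measurable X]setTI.
    exact: measurable_tnth.
  by rewrite -bigcap_seq; apply/seteqP; split => t /= h i; [move=> _|];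
    apply: h => //=; rewrite mem_index_enum.
rewrite -product_measure1E//; congr (product_measure1 _ _ _).
apply/seteqP; split => -[x t] /=.
  move=> h; split; first exact: (h ord0).
  by move=> i; have := h (lift ord0 i); rewrite tnthS.
move=> [h0 h1] i; case: (unliftP ord0 i) => [j|] ->//.
by rewrite tnthS; exact: h1.
Qed.

End iid_law.

(* R^m is m.-tuple R, whose sigma-algebra is generated by the coordinates.
   ('rV[R]_m carries the sup norm and no sigma-algebra.) *)
Section gauss_kernel.
Context {R : realType} {m : nat}.

Definition sqdist (v w : m.-tuple R) : R :=
  \sum_(i < m) (tnth v i - tnth w i) ^+ 2.

Definition gauss (sigma : R) (v w : m.-tuple R) : R :=
  expR (- (sigma ^+ 2 * sqdist v w / 2)).

End gauss_kernel.

Notation triple R dX dY dZ :=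
  (dX.-tuple R * dY.-tuple R * dZ.-tuple R)%type.

(* ((X, Y, Z), X') *)
Notation augmented R dX dY dZ := (triple R dX dY dZ * dX.-tuple R)%type.

Section statistic.
Context {R : realType} {dX dY dZ : nat}.

Definition vec (w : augmented R dX dY dZ) : (dX + dY + dZ).-tuple R :=
  let: (x, y, z, _) := w in [tuple of (x ++ y) ++ z].

Definition vec' (w : augmented R dX dY dZ) : (dX + dY + dZ).-tuple R :=
  let: (_, y, z, x') := w in [tuple of (x' ++ y) ++ z].

Definition zeta_hat (sigma : R) (n : nat)
    (D : n.-tuple (augmented R dX dY dZ)) : R :=
  'C(n, 2)%:R^-1 * \sum_(i < n) \sum_(j < n | (i < j)%N)
    (gauss sigma (vec (tnth D i)) (vec (tnth D j))
     + gauss sigma (vec' (tnth D i)) (vec' (tnth D j))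
     - gauss sigma (vec (tnth D i)) (vec' (tnth D j))
     - gauss sigma (vec' (tnth D i)) (vec (tnth D j))).

(* (U, Y, Z, U') with U = b X + (1 - b) X' and U' = (1 - b) X + b X' *)
Definition swap (b : bool) (w : augmented R dX dY dZ) : augmented R dX dY dZ :=
  let: (x, y, z, x') := w in if b then (x, y, z, x') else (x', y, z, x).

Definition zeta_hat_perm (sigma : R) (n : nat) (s : {ffun 'I_n -> bool})
    (D : n.-tuple (augmented R dX dY dZ)) : R :=
  zeta_hat sigma [tuple swap (s i) (tnth D i) | i < n].

Definition crit_value (sigma alpha : R) (n : nat)
    (D : n.-tuple (augmented R dX dY dZ)) : R :=
  inf [set t : R | 1 - alpha <=
    (2 ^+ n)^-1 *
    \sum_(s : {ffun 'I_n -> bool}) ((zeta_hat_perm sigma s D <= t)%R : nat)%:R].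

End statistic.

Section testing.
Context {R : realType} {dX dY dZ : nat}.
Implicit Types (F : probability (triple R dX dY dZ) R)
  (k : R.-pker dZ.-tuple R ~> dX.-tuple R).
Local Open Scope ereal_scope.

(* k is a version of the conditional distribution P_{X|Z} under F. *)
Definition is_cond_law F k : Prop :=
  forall (A : set (dX.-tuple R)) (B : set (dZ.-tuple R)),
    measurable A -> measurable B ->
    F [set v | A v.1.1 /\ B v.2] = \int[F]_(v in [set v | B v.2]) k v.2 A.

Definition zeta (sigma : R) F k : \bar R :=
  let Q := extend_law F k in
  'E_(Q \x Q)[fun w => gauss sigma (vec w.1) (vec w.2)]
  + 'E_(Q \x Q)[fun w => gauss sigma (vec' w.1) (vec' w.2)]
  - 2%:E * 'E_(Q \x Q)[fun w => gauss sigma (vec w.1) (vec' w.2)].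

Definition type2_error (sigma alpha : R) (n : nat) F k : \bar R :=
  iid_law (extend_law F k) n
    [set D | (zeta_hat sigma D <= crit_value sigma alpha D)%R].

End testing.

(* Regular conditional distributions on Euclidean spaces exist, and any two
   versions agree almost surely, so the supremum over pairs (F, k) is the
   supremum over the laws F. *)
Definition max_type2_error {R : realType} (dX dY dZ : nat) (sigma alpha : R)
    (n : nat) (eps : R) : \bar R :=
  ereal_sup [set p | exists (F : probability (triple R dX dY dZ) R)
      (k : R.-pker dZ.-tuple R ~> dX.-tuple R),
    [/\ is_cond_law F k, (eps%:E < zeta sigma F k)%E
      & p = type2_error sigma alpha n F k]].

(* Main.v *)
Require Import Defs.
From HB Require Import structures.
From mathcomp Require Import all_boot all_order all_algebra.
From mathcomp Require Import all_classical all_reals all_analysis measurable_realfun.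
From mathcomp Require Import ring lra zify.
Import Order.TTheory GRing.Theory Num.Theory.
Import numFieldNormedType.Exports.
Local Open Scope ring_scope.

Set Implicit Arguments.
Unset Strict Implicit.
Unset Printing Implicit Defensive.

(** The summand of the statistic, [contrast w1 w2], is the inner product
    <phi w1, phi w2> in the reproducing kernel Hilbert space of the Gaussian
    kernel, where phi w = K(vec w, .) - K(vec' w, .).  Write theta for its mean
    over two independent observations, so that theta = |E phi|^2 is the
    population discrepancy [zeta], and N for the binomial coefficient (n, 2).
    The bound holds for each fixed n >= 2 and compares three quantities of
    order 1/n.

    The signal: theta > c/n on the alternative.

    The critical value: exchanging X and X' in an observation changes the sign
    of phi, so the resampled statistics are the Rademacher chaoses
    N^-1 sum_{i<j} e_i e_j <phi w_i, phi w_j>.  Given the data their mean is 0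
    and their second moment is at most 4/N, because the contrast is at most 2
    in absolute value ([sum_sqr_rademacher_chaos]).  By Chebyshev's inequality
    for the uniform law of the signs, a positive statistic z below the critical
    value satisfies alpha z^2 <= 4/N ([zeta_hat_le_crit_sqr]), whatever the
    data; this makes z <= theta / 2 as soon as c >= 8/alpha.

    The fluctuation of the statistic: Efron and Stein's inequality bounds the
    variance of the sum S = sum_{i<j} <phi w_i, phi w_j> by the expected sum
    over i of the squares of the terms that involve w_i, that is of
    <phi w_i, sum_{j != i} phi w_j>.  By the Cauchy-Schwarz inequality these
    are bounded by multiples of |sum_j phi w_j|^2 = 2 S + O(n), whose mean is
    2 N theta + O(n) ([variance_pair_sum]).  Dividing by N^2, the variance of
    the statistic is O(theta / n + 1 / n^2) with absolute constants.

    Acceptance thus forces a deviation theta / 2 from the mean, and its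
    probability is at most 4 Var / theta^2 <= 256 / (n theta) < 256 / c, once
    n theta > 8 ([acceptance_prob_le]).  All the constants are free of the dimensions, of
    sigma and of the law, since these enter only through the positive
    semidefiniteness of the contrast and the bound |contrast| <= 2.

    The Hilbert space itself is replaced by positive semidefiniteness of the
    Gaussian kernel on finite families of points ([psd_gauss]). *)

(** * Positive semidefinite kernels *)

Section psd_kernels.
Context {R : realType}.

Definition psd_kernel {T : Type} (K : T -> T -> R) :=
  forall (I : finType) (p : I -> T) (a : I -> R),
    0 <= \sum_i \sum_j a i * a j * K (p i) (p j).

Lemma psd_kernel_cst {T : Type} (c : R) : 0 <= c ->
  psd_kernel (fun _ _ : T => c).
Proof.
move=> c0 I p a; rewrite (_ : \sum_i _ = c * (\sum_i a i) ^+ 2).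
  by rewrite mulr_ge0// sqr_ge0.
rewrite expr2 mulr_suml mulr_sumr; apply: eq_bigr => i _.
by rewrite !mulr_sumr; apply: eq_bigr => j _; ring.
Qed.

Lemma psd_kernelM_rank1 {T : Type} (f : T -> R) (K : T -> T -> R) :
  psd_kernel K -> psd_kernel (fun v w => f v * f w * K v w).
Proof.
move=> pK I p a; rewrite (_ : \sum_i _ =
    \sum_i \sum_j (a i * f (p i)) * (a j * f (p j)) * K (p i) (p j)).
  exact: pK.
by apply: eq_bigr => i _; apply: eq_bigr => j _; ring.
Qed.

Lemma psd_kernel_sum {T : Type} (J : finType) (K : J -> T -> T -> R) :
  (forall j, psd_kernel (K j)) -> psd_kernel (fun v w => \sum_j K j v w).
Proof.
move=> pK I p a; rewrite (_ : \sum_i _ =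
    \sum_k \sum_i \sum_j a i * a j * K k (p i) (p j)).
  by apply: sumr_ge0 => k _; exact: pK.
rewrite [RHS]exchange_big; apply: eq_bigr => i _.
by rewrite [RHS]exchange_big; apply: eq_bigr => j _; rewrite mulr_sumr.
Qed.

Lemma psd_kernel_lim {T : Type} (Kn : nat -> T -> T -> R) (K : T -> T -> R) :
  (forall n, psd_kernel (Kn n)) ->
  (forall v w, Kn n v w @[n --> \oo] --> K v w)%classic -> psd_kernel K.
Proof.
move=> pK cK I p a.
have cS : (\sum_i \sum_j a i * a j * Kn n (p i) (p j) @[n --> \oo] -->
    \sum_i \sum_j a i * a j * K (p i) (p j))%classic.
  apply: cvg_big => [|i _]; first exact: add_continuous.
  apply: cvg_big => [|j _]; first exact: add_continuous.
  by apply: cvgM; [exact: cvg_cst|exact: cK].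
rewrite -(cvg_lim (@Rhausdorff R) cS); apply: limr_ge.
  by apply/cvg_ex; eexists; exact: cS.
by apply: nearW => n; exact: pK.
Qed.

Definition dot {m : nat} (v w : m.-tuple R) : R :=
  \sum_(i < m) tnth v i * tnth w i.

Lemma psd_kernel_dotX {m : nat} (k : nat) :
  psd_kernel (fun v w : m.-tuple R => dot v w ^+ k).
Proof.
elim: k => [|k IH]; first exact: psd_kernel_cst.
rewrite (_ : (fun v w => _) = fun v w : m.-tuple R =>
    \sum_(i < m) tnth v i * tnth w i * dot v w ^+ k).
  by apply: psd_kernel_sum => i; exact: psd_kernelM_rank1.
by apply/funext => v; apply/funext => w; rewrite exprS mulr_suml.
Qed.

(** The power series of the exponential has nonnegative coefficients, and powers
    of the dot product are positive semidefinite. *)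
Lemma psd_kernel_exp_dot {m : nat} (s : R) : 0 <= s ->
  psd_kernel (fun v w : m.-tuple R => expR (s * dot v w)).
Proof.
move=> s0; apply: (@psd_kernel_lim _ (fun n v w =>
    series (exp_coeff (s * dot v w)) n)); last first.
  by move=> v w; exact: (is_cvg_series_exp_coeff (s * dot v w)).
move=> n; rewrite (_ : (fun v w => _) = fun v w : m.-tuple R =>
    \sum_(k < n) Num.sqrt (s ^+ k / k`!%:R) * Num.sqrt (s ^+ k / k`!%:R)
                 * dot v w ^+ k).
  (* A nonnegative coefficient is the rank one kernel of its square root. *)
  apply: psd_kernel_sum => k.
  by apply: (@psd_kernelM_rank1 _ (fun=> _)); exact: psd_kernel_dotX.
apply/funext => v; apply/funext => w; rewrite /series/= big_mkord.
apply: eq_bigr => k _.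
by rewrite /exp_coeff/= -expr2 sqr_sqrtr ?divr_ge0 ?exprn_ge0// exprMn mulrAC.
Qed.

(** exp (- s |v - w|^2 / 2) = f v * f w * exp (s <v, w>) with
    f v = exp (- s |v|^2 / 2). *)
Lemma psd_gauss {m : nat} (sigma : R) : psd_kernel (@gauss R m sigma).
Proof.
pose f (v : m.-tuple R) := expR (- (sigma ^+ 2 / 2 * dot v v)).
rewrite (_ : gauss sigma = fun v w => f v * f w * expR (sigma ^+ 2 * dot v w)).
  by apply: psd_kernelM_rank1; apply: psd_kernel_exp_dot; exact: sqr_ge0.
apply/funext => v; apply/funext => w; rewrite /f -!expRD; congr expR.
rewrite (_ : sqdist v w = dot v v + dot w w - 2 * dot v w); first by field.
rewrite /sqdist /dot mulr_sumr -big_split/= -sumrB.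
by apply: eq_bigr => i _; ring.
Qed.

(** If K is the Gram kernel of Phi, the kernel below is the Gram kernel of
    Phi (u w) - Phi (u' w): a family of n points for it is a family of 2n points
    for K, the point u' w carrying the opposite coefficient. *)
Lemma psd_kernel_contrast {S T : Type} (u u' : S -> T) (K : T -> T -> R) :
  psd_kernel K -> psd_kernel (fun w1 w2 => K (u w1) (u w2)
    + K (u' w1) (u' w2) - K (u w1) (u' w2) - K (u' w1) (u w2)).
Proof.
move=> pK I p a.
have := pK (I * bool)%type (fun x => if x.2 then u (p x.1) else u' (p x.1))
  (fun x => if x.2 then a x.1 else - a x.1).
congr (0 <= _).
pose F (x y : I * bool) := (if x.2 then a x.1 else - a x.1) *
  (if y.2 then a y.1 else - a y.1) *
  K (if x.2 then u (p x.1) else u' (p x.1))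
    (if y.2 then u (p y.1) else u' (p y.1)).
rewrite -[LHS](pair_big xpredT xpredT
  (fun i b => \sum_y F (i, b) y))/=.
apply: eq_bigr => i _; rewrite exchange_big.
rewrite -[LHS](pair_big xpredT xpredT (fun j c => \sum_b F (i, b) (j, c)))/=.
by apply: eq_bigr => j _; rewrite !big_bool /F/=; ring.
Qed.

(** This is <phi_k, sum_j phi_j>^2 <= |phi_k|^2 * |sum_j phi_j|^2, obtained from
    |sum_j phi_j + l phi_k|^2 >= 0.  An upper bound [b] of |phi_k|^2 allows
    l = - <phi_k, sum_j phi_j> / b even when phi_k = 0. *)
Lemma psd_kernel_cauchy_schwarz {T : Type} (K : T -> T -> R) (I : finType)
    (p : I -> T) (b : R) (k : I) :
  psd_kernel K -> (forall v w, K v w = K w v) -> 0 < b -> K (p k) (p k) <= b ->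
  (\sum_j K (p k) (p j)) ^+ 2 <= b * \sum_i \sum_j K (p i) (p j).
Proof.
move=> pK sK b0 Kb.
set M := (X in X ^+ 2); set Q := (X in b * X).
pose l := - M / b.
have := pK I p (fun i => 1 + l * (i == k)%:R).
rewrite (_ : \sum_i _ = Q + l * M + l * M + l ^+ 2 * K (p k) (p k)); last first.
  rewrite [in LHS](eq_bigr (fun i => \sum_j K (p i) (p j)
      + l * (\sum_j (j == k)%:R * K (p i) (p j))
      + (i == k)%:R * (l * (\sum_j K (p i) (p j))
         + l ^+ 2 * \sum_j (j == k)%:R * K (p i) (p j)))); last first.
    move=> i _; rewrite mulrDr !mulr_sumr -!big_split/=.
    by apply: eq_bigr => j _; ring.
  have pick (G : I -> R) : \sum_j (j == k)%:R * G j = G k.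
    rewrite (bigD1 k)//= eqxx mul1r big1 ?addr0// => j /negbTE ->.
    by rewrite mul0r.
  rewrite !big_split/= pick !pick -/Q -mulr_sumr -/M !addrA; congr (_ + _ + _ + _).
  by congr (l * _); apply: eq_bigr => i _; rewrite pick sK.
rewrite /l => H; rewrite -subr_ge0.
have {H} : 0 <= b * (Q + - M / b * M + - M / b * M + (- M / b) ^+ 2 * b).
  rewrite pmulr_rge0//; apply: (le_trans H); rewrite lerD2l.
  by rewrite ler_wpM2l// sqr_ge0.
by congr (0 <= _); field; rewrite gt_eqF.
Qed.

End psd_kernels.

(** * Expectation of bounded measurable functions *)

Section bounded_measurable.
Context {d : measure_display} {T : measurableType d} {R : realType}.
Implicit Types (f g : T -> R) (P : probability T R).

(** Every random quantity of the problem is bounded; this class is closed under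
    the ring operations and partial integration, and makes all the
    integrability conditions automatic. *)
Definition bounded_mfun f :=
  measurable_fun [set: T]%classic f /\ exists M, forall x, `|f x| <= M.

Lemma bounded_mfun_cst (c : R) : bounded_mfun (fun=> c).
Proof. by split; [exact: measurable_cst|exists `|c|]. Qed.

Lemma bounded_mfunD f g : bounded_mfun f -> bounded_mfun g ->
  bounded_mfun (fun x => f x + g x).
Proof.
move=> [mf [M Mf]] [mg [N Ng]]; split; first exact: measurable_funD.
by exists (M + N) => x; rewrite (le_trans (ler_normD _ _))// lerD.
Qed.

Lemma bounded_mfunM f g : bounded_mfun f -> bounded_mfun g ->
  bounded_mfun (fun x => f x * g x).
Proof.
move=> [mf [M Mf]] [mg [N Ng]]; split; first exact: measurable_funM.
by exists (M * N) => x; rewrite normrM ler_pM.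
Qed.

Lemma bounded_mfunZ (c : R) f : bounded_mfun f -> bounded_mfun (fun x => c * f x).
Proof. by move=> bf; apply: bounded_mfunM => //; exact: bounded_mfun_cst. Qed.

Lemma bounded_mfunB f g : bounded_mfun f -> bounded_mfun g ->
  bounded_mfun (fun x => f x - g x).
Proof.
move=> bf bg; rewrite (_ : (fun x => _) = fun x => f x + (-1) * g x).
  by apply: bounded_mfunD => //; exact: bounded_mfunZ.
by apply/funext => x; rewrite mulN1r.
Qed.

Lemma bounded_mfunX f n : bounded_mfun f -> bounded_mfun (fun x => f x ^+ n).
Proof.
move=> bf; elim: n => [|n IH]; first exact: bounded_mfun_cst.
rewrite (_ : (fun x => _) = fun x => f x * f x ^+ n); first exact: bounded_mfunM.
by apply/funext => x; rewrite exprS.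
Qed.

Lemma bounded_mfun_sum (I : Type) (r : seq I) (p : pred I) (F : I -> T -> R) :
  (forall i, p i -> bounded_mfun (F i)) ->
  bounded_mfun (fun x => \sum_(i <- r | p i) F i x).
Proof.
move=> bF; elim: r => [|i r IH].
  by under eq_fun do rewrite big_nil; exact: bounded_mfun_cst.
case pi : (p i); under eq_fun do rewrite big_cons pi; last exact: IH.
by apply: bounded_mfunD => //; exact: bF.
Qed.

Lemma bounded_mfun_integrable P f :
  bounded_mfun f -> P.-integrable [set: T]%classic (EFin \o f).
Proof.
move=> [mf [M Mf]]; apply: measurable_bounded_integrable => //.
  by rewrite (le_lt_trans (probability_le1 P measurableT))// ltry.
exists M; split; first exact: num_real.
by move=> N MN x _; rewrite /= (le_trans (Mf x))// ltW.
Qed.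

Lemma expect_cst P (c : R) : \int[P]_x c = c.
Proof. by rewrite Rintegral_cst// [X in fine X]probability_setT mulr1. Qed.

Lemma expectD P f g : bounded_mfun f -> bounded_mfun g ->
  \int[P]_x (f x + g x) = \int[P]_x f x + \int[P]_x g x.
Proof. by move=> bf bg; apply: RintegralD => //; exact: bounded_mfun_integrable. Qed.

Lemma expectB P f g : bounded_mfun f -> bounded_mfun g ->
  \int[P]_x (f x - g x) = \int[P]_x f x - \int[P]_x g x.
Proof. by move=> bf bg; apply: RintegralB => //; exact: bounded_mfun_integrable. Qed.

Lemma expectZ P (c : R) f : bounded_mfun f ->
  \int[P]_x (c * f x) = c * \int[P]_x f x.
Proof. by move=> bf; apply: RintegralZl => //; exact: bounded_mfun_integrable. Qed.

Lemma le_expect P f g : bounded_mfun f -> bounded_mfun g ->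
  (forall x, f x <= g x) -> \int[P]_x f x <= \int[P]_x g x.
Proof.
by move=> bf bg fg; apply: le_Rintegral => //; exact: bounded_mfun_integrable.
Qed.

Lemma expect_sum P (I : Type) (r : seq I) (p : pred I) (F : I -> T -> R) :
  (forall i, p i -> bounded_mfun (F i)) ->
  \int[P]_x (\sum_(i <- r | p i) F i x) = \sum_(i <- r | p i) \int[P]_x F i x.
Proof.
move=> bF; elim: r => [|i r IH].
  by rewrite big_nil; under eq_Rintegral do rewrite big_nil; rewrite expect_cst.
rewrite big_cons -IH; case pi : (p i).
  under eq_Rintegral do rewrite big_cons pi.
  by rewrite expectD//; [exact: bF|exact: bounded_mfun_sum].
by under eq_Rintegral do rewrite big_cons pi.
Qed.

Lemma expect_sqrB P f (c : R) : bounded_mfun f ->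
  \int[P]_x (f x - c) ^+ 2 =
  \int[P]_x f x ^+ 2 - (\int[P]_x f x) ^+ 2 + (\int[P]_x f x - c) ^+ 2.
Proof.
move=> bf; have b2 : bounded_mfun (fun x => f x ^+ 2) by exact: bounded_mfunX.
have bc := bounded_mfun_cst.
have bZ : bounded_mfun (fun x => (2 * c) * f x) by exact: bounded_mfunZ.
under eq_Rintegral.
  move=> x _; rewrite (_ : _ ^+ 2 = f x ^+ 2 - 2 * c * f x + c ^+ 2); last by ring.
  over.
rewrite expectD//; last exact: bounded_mfunB.
by rewrite expectB// expectZ// expect_cst; ring.
Qed.

Lemma sqr_expect_le P f : bounded_mfun f ->
  (\int[P]_x f x) ^+ 2 <= \int[P]_x f x ^+ 2.
Proof.
move=> bf; rewrite -subr_ge0 -[leRHS]addr0.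
have := expect_sqrB P (\int[P]_x f x) bf; rewrite subrr expr0n/= => <-.
by apply: Rintegral_ge0 => x _; exact: sqr_ge0.
Qed.

Lemma expect_bounded P g (M : R) :
  bounded_mfun g -> (forall x, `|g x| <= M) -> `|\int[P]_x g x| <= M.
Proof.
move=> bg Mg; rewrite ler_norml -{1}(expect_cst P (- M)) -{2}(expect_cst P M).
by rewrite !le_expect//; try exact: bounded_mfun_cst;
  move=> x; have := Mg x; rewrite ler_norml => /andP[].
Qed.

End bounded_measurable.

Lemma bounded_mfun_comp {d d' : measure_display} {T : measurableType d}
    {T' : measurableType d'} {R : realType} (u : T -> T') (g : T' -> R) :
  measurable_fun [set: T]%classic u -> bounded_mfun g ->
  bounded_mfun (fun x => g (u x)).
Proof.
move=> mu [mg [M Mg]]; split; first exact: measurableT_comp mg mu.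
by exists M => x; exact: Mg.
Qed.

(** * Product laws, i.i.d. laws and the Efron-Stein inequality *)

Section fubini.
Context {d1 d2 : measure_display} {T1 : measurableType d1}
  {T2 : measurableType d2} {R : realType}.
Variables (P : probability T1 R) (Q : probability T2 R) (f : T1 * T2 -> R).
Hypothesis bf : bounded_mfun f.

Lemma bounded_mfun_sectionl y : bounded_mfun (fun x => f (x, y)).
Proof. by apply: bounded_mfun_comp bf; exact: measurable_fun_pair. Qed.

Lemma bounded_mfun_sectionr x : bounded_mfun (fun y => f (x, y)).
Proof. by apply: bounded_mfun_comp bf; exact: measurable_fun_pair. Qed.

Lemma bounded_mfun_expectl : bounded_mfun (fun y => \int[P]_x f (x, y)).
Proof.
case: (bf) => _ [M Mf]; split; last first.
  exists M => y; apply: expect_bounded => //; exact: bounded_mfun_sectionl.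
apply: measurableT_comp => //.
apply: (@measurable_fubini_G _ _ _ _ _ P Q (EFin \o f)).
exact: (@bounded_mfun_integrable _ _ _ (P \x Q)%E).
Qed.

Lemma bounded_mfun_expectr : bounded_mfun (fun x => \int[Q]_y f (x, y)).
Proof.
case: (bf) => _ [M Mf]; split; last first.
  exists M => x; apply: expect_bounded => //; exact: bounded_mfun_sectionr.
apply: measurableT_comp => //.
apply: (@measurable_fubini_F _ _ _ _ _ P Q (EFin \o f)).
exact: (@bounded_mfun_integrable _ _ _ (P \x Q)%E).
Qed.

Lemma expect_fubini21 : \int[(P \x Q)%E]_w f w = \int[Q]_y \int[P]_x f (x, y).
Proof.
congr fine; rewrite -(@integral21_prod_meas1 _ _ _ _ _ P Q).
  apply: eq_integral => y _; rewrite fineK//.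
  apply: integrable_fin_num => //.
  by apply: bounded_mfun_integrable; exact: bounded_mfun_sectionl.
exact: (@bounded_mfun_integrable _ _ _ (P \x Q)%E).
Qed.

Lemma expect_fubini12 : \int[(P \x Q)%E]_w f w = \int[P]_x \int[Q]_y f (x, y).
Proof.
congr fine; rewrite -(@integral12_prod_meas1 _ _ _ _ _ P Q).
  apply: eq_integral => y _; rewrite fineK//.
  apply: integrable_fin_num => //.
  by apply: bounded_mfun_integrable; exact: bounded_mfun_sectionr.
exact: (@bounded_mfun_integrable _ _ _ (P \x Q)%E).
Qed.

End fubini.

Section iid.
Context {d : measure_display} {T : measurableType d} {R : realType}.
Variable P : probability T R.

Lemma measurable_cons_pair n : measurable_fun setT (@cons_pair d T n).
Proof. exact: measurable_cons. Qed.

Lemma expect_iid0 (f : 0.-tuple T -> R) :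
  \int[iid_law P 0]_t f t = f [tuple].
Proof.
rewrite (_ : f = fun=> f [tuple]) ?expect_cst//.
by apply/funext => t; rewrite tuple0.
Qed.

Lemma expect_iidS n (f : n.+1.-tuple T -> R) : bounded_mfun f ->
  \int[iid_law P n.+1]_t f t =
  \int[iid_law P n]_t \int[P]_x f (cons_pair (x, t)).
Proof.
move=> bf; rewrite -(expect_fubini21 P (iid_law P n) (f := f \o @cons_pair _ _ n)).
  congr fine; rewrite integral_pushforward//.
  - by apply/measurable_EFinP; exact: (bf.1).
  - apply: (@bounded_mfun_integrable _ _ _ (P \x iid_law P n)%E (f \o _)).
    by apply: bounded_mfun_comp bf; exact: measurable_cons_pair.
by apply: bounded_mfun_comp bf; exact: measurable_cons_pair.
Qed.

Definition coord_free {n : nat} (i : 'I_n) (g : n.-tuple T -> R) :=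
  forall t t' : n.-tuple T,
    (forall j, j != i -> tnth t j = tnth t' j) -> g t = g t'.

(** The variance is subadditive over the coordinates.  By induction, conditioning
    on the tail t of the tuple splits the variance of f into the mean over t of
    its variance in the head, which the constant g ord0 bounds because a
    variance is the least mean square distance to a constant, and the variance
    of the function F obtained by averaging out the head.  The induction
    hypothesis applies to F with the averages G of the other g, and Jensen's
    inequality bounds (F - G)^2 by the average of (f - g)^2. *)
Lemma efron_stein n (f : n.-tuple T -> R) (g : 'I_n -> n.-tuple T -> R) :
  bounded_mfun f -> (forall i, bounded_mfun (g i)) ->
  (forall i, coord_free i (g i)) ->
  \int[iid_law P n]_t f t ^+ 2 - (\int[iid_law P n]_t f t) ^+ 2 <=
  \sum_(i < n) \int[iid_law P n]_t (f t - g i t) ^+ 2.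
Proof.
elim: n f g => [|n IH] f g bf bg fg.
  by rewrite !expect_iid0 subrr big_ord0.
have b2 : bounded_mfun (fun t => f t ^+ 2) by exact: bounded_mfunX.
have bD i : bounded_mfun (fun t => (f t - g i t) ^+ 2).
  by apply: bounded_mfunX; exact: bounded_mfunB.
have bC (k : n.+1.-tuple T -> R) : bounded_mfun k -> bounded_mfun (k \o @cons_pair _ T n).
  by apply: bounded_mfun_comp; exact: measurable_cons_pair.
have bE (k : n.+1.-tuple T -> R) : bounded_mfun k ->
    bounded_mfun (fun t => \int[P]_x k (cons_pair (x, t))).
  by move=> bk; exact: (bounded_mfun_expectl P (iid_law P n) (bC _ bk)).
have bS (k : n.+1.-tuple T -> R) t : bounded_mfun k ->
    bounded_mfun (fun x => k (cons_pair (x, t))).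
  by move=> bk; exact: (bounded_mfun_sectionl (bC _ bk)).
rewrite !expect_iidS// big_ord_recl.
under [X in _ <= _ + X]eq_bigr do rewrite expect_iidS//.
rewrite expect_iidS//.
pose F t := \int[P]_x f (cons_pair (x, t)).
pose G i t := \int[P]_x g (lift ord0 i) (cons_pair (x, t)).
have bF : bounded_mfun F by exact: bE.
have bG i : bounded_mfun (G i) by exact: bE.
have fG i : coord_free i (G i).
  move=> t t' tt'; apply: eq_Rintegral => x _; apply: fg => j.
  case: (unliftP ord0 j) => [k|] -> kl; last by rewrite !(tnth_nth x).
  rewrite !tnthS; apply: tt'; apply: contraNneq kl => ->; exact: eqxx.
have := IH F G bF bG fG; rewrite -/F => {}IH.
rewrite -[leLHS](subrKA (\int[iid_law P n]_t F t ^+ 2)) lerD//.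
  have bE2 := bE _ b2.
  rewrite -expectB//; last exact: bounded_mfunX.
  apply: le_expect; [|exact: (bE _ (bD _))|].
    by apply: bounded_mfunB => //; exact: bounded_mfunX.
  (* g ord0 ignores the head, so any value may stand for it. *)
  move=> t; rewrite [X in _ <= X](_ : _ =
      \int[P]_x (f (cons_pair (x, t)) - g ord0 (cons_pair (point, t))) ^+ 2).
    by rewrite expect_sqrB; [rewrite lerDl sqr_ge0|exact: bS].
  apply: eq_Rintegral => x _; congr ((_ - _) ^+ 2); apply: fg => j.
  by case: (unliftP ord0 j) => [k|] -> //; rewrite !tnthS.
apply: (le_trans IH); apply: ler_sum => i _.
apply: le_expect; [exact/bounded_mfunX/bounded_mfunB|exact: (bE _ (bD _))|].
move=> t; rewrite -expectB; [|exact: bS..].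
by apply: sqr_expect_le; apply: bounded_mfunB; exact: bS.
Qed.

End iid.

(** * Moments of sums over pairs *)

Section pair_sum.
Context {T : Type} {R : realType}.
Variables (h : T -> T -> R) (b : R).
Hypotheses (hC : forall v w, h v w = h w v) (h_psd : psd_kernel h)
  (b0 : 0 < b) (hb : forall v w, `|h v w| <= b).

Definition pair_sum {n : nat} (t : n.-tuple T) : R :=
  \sum_(i < n) \sum_(j < n | (i < j)%N) h (tnth t i) (tnth t j).

Definition pair_sum_at {n : nat} (i : 'I_n) (t : n.-tuple T) : R :=
  \sum_(j < n | j != i) h (tnth t i) (tnth t j).

(** The factor 1/2 compensates for summing over ordered pairs, a form that makes
    the decomposition [pair_sum_split] a rearrangement of one double sum. *)
Definition pair_sum_off {n : nat} (i : 'I_n) (t : n.-tuple T) : R :=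
  2^-1 * \sum_(k < n | k != i) \sum_(l < n | (l != k) && (l != i))
    h (tnth t k) (tnth t l).

Lemma pair_sum_double {n : nat} (t : n.-tuple T) :
  2 * pair_sum t = \sum_(k < n) pair_sum_at k t.
Proof.
rewrite mulr_natl mulr2n /pair_sum [X in _ + X](exchange_big_dep xpredT)//=.
rewrite -big_split/=.
apply: eq_bigr => k _; rewrite /pair_sum_at [RHS](bigID (fun l : 'I_n => (k < l)%N))/=.
congr (_ + _).
  by apply: eq_bigl => l; rewrite -val_eqE/= neq_ltn orbC; case: ltngtP.
apply: eq_big => [l|l _]; last exact: hC.
by rewrite -val_eqE/= neq_ltn; case: ltngtP.
Qed.

Lemma pair_sum_split {n : nat} (i : 'I_n) (t : n.-tuple T) :
  pair_sum t = pair_sum_at i t + pair_sum_off i t.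
Proof.
have two0 : (2 : R) != 0 by rewrite pnatr_eq0.
apply: (mulfI two0); rewrite mulrDr pair_sum_double /pair_sum_off mulrA.
rewrite divff// mul1r (bigD1 i)//= mulr_natl mulr2n -addrA; congr (_ + _).
rewrite {2}/pair_sum_at -big_split/=; apply: eq_bigr => k ki.
by rewrite /pair_sum_at (bigD1 i)//= 1?eq_sym// hC.
Qed.

(** With h v w = <phi v, phi w>, S = [pair_sum t] and a sum over all j, the value
    [pair_sum_at i t] is <phi_i, sum_j phi_j> - |phi_i|^2, and
    |sum_j phi_j|^2 is 2 S plus n diagonal terms bounded by b. *)
Lemma pair_sum_at_le {n : nat} (i : 'I_n) (t : n.-tuple T) :
  pair_sum_at i t ^+ 2 <= 2 * b * (2 * pair_sum t + n%:R * b) + 2 * b ^+ 2.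
Proof.
have hbb v w : h v w <= b by exact: le_trans (ler_norm _) (hb v w).
have := psd_kernel_cauchy_schwarz (p := tnth t) (k := i) h_psd hC b0 (hbb _ _).
rewrite (bigD1 i)//= -/(pair_sum_at i t).
rewrite [X in _ <= b * X](_ : _ = 2 * pair_sum t + \sum_k h (tnth t k) (tnth t k)).
  set H := h _ _; set L := pair_sum_at i t; set D := \sum_k _ => HL.
  have H2 : H ^+ 2 <= b ^+ 2.
    have /andP[H1 H2] : - b <= H <= b by rewrite -ler_norml hb.
    by rewrite -subr_ge0 subr_sqr mulr_ge0// ?subr_ge0// addrC -lerBlDr sub0r.
  have D2 : b * D <= b * (n%:R * b).
    rewrite ler_pM2l//; apply: (@le_trans _ _ (\sum_(k < n) b)).
      by apply: ler_sum => k _.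
    by rewrite sumr_const card_ord mulr_natl.
  (* L^2 <= 2 (H + L)^2 + 2 H^2 *)
  have := sqr_ge0 (2 * H + L); nra.
rewrite pair_sum_double -big_split/=; apply: eq_bigr => k _.
by rewrite (bigD1 k)//= addrC.
Qed.

End pair_sum.

Lemma sum_ltn_pairs {R : realType} (n : nat) :
  \sum_(i < n) \sum_(j < n | (i < j)%N) 1 = 'C(n, 2)%:R :> R.
Proof.
rewrite (exchange_big_dep xpredT)//= -bin2_sum big_mkord natr_sum; apply: eq_bigr => j _.
by rewrite (big_ord_narrow (ltnW (ltn_ord j))) sumr_const card_ord.
Qed.

Section pair_sum_moments.
Context {d : measure_display} {T : measurableType d} {R : realType}.
Variables (P : probability T R) (h : T -> T -> R) (b : R).
Hypotheses (hC : forall v w, h v w = h w v) (h_psd : psd_kernel h)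
  (b0 : 0 < b) (hb : forall v w, `|h v w| <= b)
  (hm : measurable_fun [set: T * T]%classic (fun w => h w.1 w.2)).

Let bh : bounded_mfun (fun w : T * T => h w.1 w.2).
Proof. by split => //; exists b. Qed.

Let bhh n (i j : 'I_n) :
  bounded_mfun (fun t : n.-tuple T => h (tnth t i) (tnth t j)).
Proof.
apply: (bounded_mfun_comp (u := fun t : n.-tuple T => (tnth t i, tnth t j)) _ bh).
by apply: measurable_fun_pair; exact: measurable_tnth.
Qed.

Let theta := \int[(P \x P)%E]_w h w.1 w.2.

Lemma expect_tnth n (i : 'I_n) (f : T -> R) : bounded_mfun f ->
  \int[iid_law P n]_t f (tnth t i) = \int[P]_x f x.
Proof.
move=> bf; have bfi m (j : 'I_m) : bounded_mfun (fun t : m.-tuple T => f (tnth t j)).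
  by apply: bounded_mfun_comp bf; exact: measurable_tnth.
elim: n i => [[]//|n IH] i; rewrite expect_iidS//.
case: (unliftP ord0 i) => [j|] ->.
  rewrite -(IH j); apply: eq_Rintegral => t _.
  by under eq_Rintegral do rewrite tnthS/=; rewrite expect_cst.
by rewrite -[RHS](expect_cst (iid_law P n)).
Qed.

Lemma expect_pair n (i j : 'I_n) : (i < j)%N ->
  \int[iid_law P n]_t h (tnth t i) (tnth t j) = theta.
Proof.
elim: n i j => [[]//|n IH] i j ij; rewrite expect_iidS//.
case: (unliftP ord0 j) ij => [j'|] ->//.
case: (unliftP ord0 i) => [i'|] -> ij.
  rewrite -(IH i' j' ij); apply: eq_Rintegral => t _.
  by under eq_Rintegral do rewrite !tnthS/=; rewrite expect_cst.
rewrite /theta (expect_fubini21 P P bh)/=.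
rewrite -(expect_tnth j' (bounded_mfun_expectl P P bh)).
by apply: eq_Rintegral => t _; apply: eq_Rintegral => x _; rewrite tnthS.
Qed.

Lemma bounded_mfun_pair_sum n : bounded_mfun (@pair_sum T R h n).
Proof. by do 2! apply: bounded_mfun_sum => ? _; exact: bhh. Qed.

Lemma expect_pair_sum n :
  \int[iid_law P n]_t pair_sum h t = 'C(n, 2)%:R * theta.
Proof.
rewrite expect_sum => [|i _]; last by apply: bounded_mfun_sum => j _; exact: bhh.
rewrite -sum_ltn_pairs mulr_suml; apply: eq_bigr => i _.
rewrite mulr_suml expect_sum => [|j _]; last exact: bhh.
by apply: eq_bigr => j ij; rewrite mul1r expect_pair.
Qed.

(** The sum of the squares given by [efron_stein] is bounded by an affine function
    of the pair sum itself, whose mean is known; hence the term of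
    order n^3 in the variance carries the small factor [theta]. *)
Lemma variance_pair_sum n :
  \int[iid_law P n]_t pair_sum h t ^+ 2 - ('C(n, 2)%:R * theta) ^+ 2 <=
  4 * b * n%:R * ('C(n, 2)%:R * theta) + 2 * b ^+ 2 * n%:R * (n%:R + 1).
Proof.
have bS := @bounded_mfun_pair_sum n.
have bO i : bounded_mfun (@pair_sum_off T R h n i).
  by apply: bounded_mfunZ; do 2! apply: bounded_mfun_sum => ? _; exact: bhh.
rewrite -expect_pair_sum; apply: (le_trans (efron_stein P bS bO _)).
  move=> i t t' tt'; rewrite /pair_sum_off; congr (_ * _).
  apply: eq_bigr => k ki; apply: eq_bigr => l /andP[_ li].
  by rewrite (tt' k)// (tt' l).
have -> : 4 * b * n%:R * (\int[iid_law P n]_t pair_sum h t) +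
    2 * b ^+ 2 * n%:R * (n%:R + 1) =
    \sum_(i < n) \int[iid_law P n]_t (4 * b * pair_sum h t + 2 * b ^+ 2 * (n%:R + 1)).
  rewrite sumr_const card_ord expectD ?expect_cst ?expectZ//.
  - by rewrite -mulr_natl; ring.
  - exact: bounded_mfunZ.
  - exact: bounded_mfun_cst.
apply: ler_sum => i _; apply: le_expect.
- by apply: bounded_mfunX; exact: bounded_mfunB.
- by apply: bounded_mfunD; [exact: bounded_mfunZ|exact: bounded_mfun_cst].
move=> t; rewrite (pair_sum_split hC i) addrK.
have := pair_sum_at_le hC h_psd b0 hb i t; rewrite -(pair_sum_split hC i) => H.
by apply: (le_trans H); rewrite le_eqVlt; apply/orP; left; apply/eqP; ring.
Qed.

End pair_sum_moments.

(** * Random signs and empirical quantiles *)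

Section rademacher.
Context {R : realType}.

Definition rsign (b : bool) : R := if b then 1 else -1.

Definition flip {n : nat} (m : 'I_n) (s : {ffun 'I_n -> bool}) :
  {ffun 'I_n -> bool} := [ffun k => (k == m) (+) s k].

Lemma flipK {n : nat} (m : 'I_n) : involutive (flip m).
Proof. by move=> s; apply/ffunP => k; rewrite !ffunE addbA addbb. Qed.

Lemma sum_rsign_odd {n : nat} (m : 'I_n) (g : {ffun 'I_n -> bool} -> R) :
  (forall s, g (flip m s) = g s) ->
  \sum_(s : {ffun 'I_n -> bool}) rsign (s m) * g s = 0.
Proof.
move=> gm; set A := LHS; have AN : A = - A.
  rewrite {1}/A (reindex_inj (inv_inj (flipK m)))/= -sumrN.
  apply: eq_bigr => s _; rewrite gm ffunE eqxx /rsign; case: (s m) => /=; ring.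
by apply/eqP; have := subrr A; rewrite {2}AN opprK -mulr2n => /eqP;
  rewrite mulrn_eq0.
Qed.

(** If the two pairs differ, an index of the first one is missing from the second,
    so its sign occurs once in the product and the sum cancels. *)
Lemma sum_rsign_pairs {n : nat} (i j k l : 'I_n) : (i < j)%N -> (k < l)%N ->
  \sum_(s : {ffun 'I_n -> bool})
    (rsign (s i) * rsign (s j)) * (rsign (s k) * rsign (s l)) =
  2 ^+ n * ((i, j) == (k, l))%:R.
Proof.
move=> ij kl.
have [[<- <-]|ne] := eqVneq (i, j) (k, l).
  rewrite mulr1 (eq_bigr (fun=> 1)) => [|s _].
    by rewrite sumr_const card_ffun card_bool card_ord natrX.
  by rewrite /rsign; case: (s i); case: (s j); ring.
rewrite mulr0.
have fl (m a : 'I_n) s : a != m -> flip m s a = s a.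
  by move=> /negbTE am; rewrite ffunE am.
have [ik|ik] := boolP ((k != i) && (l != i)).
  have /andP[ki li] := ik.
  rewrite -[RHS](sum_rsign_odd (m := i)
    (g := fun s => rsign (s j) * (rsign (s k) * rsign (s l)))).
    by apply: eq_bigr => s _; rewrite -mulrA.
  by move=> s /=; rewrite !fl// -val_eqE/= gtn_eqF.
have [kj lj] : k != j /\ l != j.
  move: ik ne ij kl; rewrite xpair_eqE negb_and !negbK -!val_eqE/=.
  by move: i j k l => [i ?] [j ?] [k ?] [l ?] /=; lia.
rewrite -[RHS](sum_rsign_odd (m := j)
  (g := fun s => rsign (s i) * (rsign (s k) * rsign (s l)))).
  by apply: eq_bigr => s _; ring.
by move=> s /=; rewrite !fl// -val_eqE/= ltn_eqF.
Qed.

(** Parseval's identity: under the uniform law of the signs the products e_i e_j,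
    i < j, are orthonormal. *)
Lemma sum_sqr_rademacher_chaos {n : nat} (a : 'I_n -> 'I_n -> R) :
  \sum_(s : {ffun 'I_n -> bool}) (\sum_(i < n) \sum_(j < n | (i < j)%N)
            rsign (s i) * rsign (s j) * a i j) ^+ 2 =
  2 ^+ n * \sum_(i < n) \sum_(j < n | (i < j)%N) a i j ^+ 2.
Proof.
pose lt (p : 'I_n * 'I_n) := (p.1 < p.2)%N.
pose chi (s : {ffun 'I_n -> bool}) (p : 'I_n * 'I_n) :=
  rsign (s p.1) * rsign (s p.2).
pose A (p : 'I_n * 'I_n) := a p.1 p.2.
rewrite (eq_bigr (fun s => \sum_(p | lt p) \sum_(q | lt q)
    A p * A q * (chi s p * chi s q))) => [|s _]; last first.
  rewrite (pair_big_dep xpredT (fun i j : 'I_n => (i < j)%N))/= expr2 mulr_suml.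
  apply: eq_bigr => p _; rewrite mulr_sumr; apply: eq_bigr => q _.
  by rewrite /chi /A; ring.
rewrite exchange_big/= (pair_big_dep xpredT (fun i j : 'I_n => (i < j)%N))/=.
rewrite mulr_sumr; apply: eq_bigr => p ltp.
rewrite exchange_big/= (bigD1 p)//= [X in _ + X]big1 => [|q /andP[ltq qp]].
  rewrite addr0 -mulr_sumr sum_rsign_pairs// eqxx mulr1 /A; ring.
rewrite -mulr_sumr sum_rsign_pairs// (_ : (_ == _) = false) ?mulr0//.
by rewrite -!surjective_pairing eq_sym; exact: negbTE.
Qed.

End rademacher.

Section empirical_quantile.
Context {R : realType} {S : finType}.
Variables (v : S -> R) (w q : R).
Hypotheses (w0 : 0 < w) (q0 : 0 < q) (q1 : q <= w * #|S|%:R).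

Let cdf (t : R) : R := w * \sum_s ((v s <= t)%R : nat)%:R.
Let cdfl (t : R) : R := w * \sum_s ((v s < t)%R : nat)%:R.

(** The infimum is attained, the empirical distribution function being right
    continuous; the right-hand side is a finite combination of comparisons,
    from which measurability of the acceptance region follows. *)
Lemma le_empirical_quantile (x : R) :
  (x <= inf [set t | q <= cdf t]%classic) = (cdfl x < q).
Proof.
pose top := \sum_s `|v s|.
have vtop s : v s <= top.
  rewrite (le_trans (ler_norm _))// /top (bigD1 s)//= lerDl.
  exact: sumr_ge0.
have Atop : q <= cdf top.
  rewrite (le_trans q1)// ler_pM2l// (eq_bigr (fun=> 1)) ?sumr_const//.
  by move=> s _; rewrite vtop.
have Alb : lbound [set t | q <= cdf t]%classic (- top).
  move=> t /= qt; rewrite leNgt; apply/negP => ttop; move: qt.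
  rewrite leNgt /cdf big1 ?mulr0 ?q0// => s _.
  rewrite (_ : (v s <= t) = false)//; apply/negbTE; rewrite -ltNge.
  rewrite (lt_le_trans ttop)// lerNl (le_trans (ler_norm _))// normrN.
  by rewrite /top (bigD1 s)//= lerDl; exact: sumr_ge0.
apply/idP/idP => [xA|xq].
  rewrite ltNge; apply/negP => qx.
  have [s0 vs0] : exists s, v s < x.
    apply/existsP; rewrite -[X in is_true X]negbK negb_exists; apply/negP.
    move=> /forallP nv; move: qx; rewrite leNgt /cdfl big1 ?mulr0 ?q0// => s _.
    by rewrite (negbTE (nv s)).
  (* The largest value below x belongs to the set of the infimum. *)
  pose s1 := [arg max_(s > s0 | v s < x) v s]%O.
  have [vs1 vmax] : v s1 < x /\ forall s, v s < x -> v s <= v s1.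
    by rewrite /s1; case: arg_maxP => // s vs vm; split => // s'; exact: vm.
  have : inf [set t | q <= cdf t]%classic <= v s1.
    apply: ge_inf; first by exists (- top).
    rewrite /= (le_trans qx)// ler_pM2l//; apply: ler_sum => s _.
    by rewrite ler_nat; case: (ltP (v s) x) => // /vmax ->.
  by rewrite leNgt (lt_le_trans vs1).
apply: lb_le_inf; first by exists top.
move=> t /= qt; rewrite leNgt; apply/negP => tx; move: xq.
rewrite ltNge => /negP; apply; rewrite (le_trans qt)// ler_pM2l//.
apply: ler_sum => s _; rewrite ler_nat.
by case: (leP (v s) t) => // vt; rewrite (le_lt_trans vt).
Qed.

(** Chebyshev's inequality: if x is at most the q-quantile, a proportion of at
    least 1 - q of the values is no smaller than x. *)
Lemma empirical_quantile_sqr (x : R) : w * #|S|%:R = 1 -> 0 < x ->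
  x <= inf [set t | q <= cdf t]%classic ->
  (1 - q) * x ^+ 2 <= w * \sum_s v s ^+ 2.
Proof.
move=> w1 x0; rewrite le_empirical_quantile => xq.
have : 1 - q <= w * \sum_s ((x <= v s)%R : nat)%:R.
  rewrite lerBlDr -[leLHS]w1 -lerBlDl -mulrBr (le_trans _ (ltW xq))// ler_pM2l//.
  have -> : #|S|%:R = \sum_(s : S) 1 :> R by rewrite sumr_const.
  rewrite -sumrB.
  by apply: ler_sum => s _; rewrite ltNge; case: (x <= v s); rewrite /= ?subr0 ?subrr.
move=> /(ler_wpM2r (sqr_ge0 x))/le_trans; apply.
rewrite -mulrA ler_pM2l// mulr_suml; apply: ler_sum => s _.
case: (leP x (v s)) => xv; last by rewrite mul0r sqr_ge0.
by rewrite mul1r lerXn2r// nnegrE ltW// (lt_le_trans x0).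
Qed.

End empirical_quantile.

(** * Comparing the rates *)

Lemma sqr_le_bin2 (n : nat) : (1 < n -> n ^ 2 <= 4 * 'C(n, 2))%N.
Proof.
move=> n1; have -> : (4 * 'C(n, 2) = n * (2 * n.-1))%N.
  by rewrite [RHS]mulnCA -[X in (n * X)%N]bin1 mul_bin_diag mulnA.
by rewrite -mulnn leq_mul2l; apply/orP; right; lia.
Qed.

Section rate_arithmetic.
Context {R : realType}.
Variables (n N theta : R).
Hypotheses (n1 : 1 <= n) (N0 : 0 < N) (nN : n ^+ 2 <= 4 * N)
  (theta8 : 8 < n * theta).

Let r0 : 0 <= n ^+ 2 / N. Proof. by rewrite divr_ge0 ?sqr_ge0// ltW. Qed.

Let r4 : n ^+ 2 / N <= 4. Proof. by rewrite ler_pdivrMr. Qed.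

Let n0 : 0 < n. Proof. exact: lt_le_trans n1. Qed.

(** If z > theta / 2, multiplying the bound on z^2 by n^2 gives
    alpha (n theta)^2 <= 64, against n theta > 8 and alpha n theta > 8. *)
Lemma threshold_le_half_signal (alpha z : R) : 0 < alpha ->
  8 < alpha * (n * theta) -> 0 <= z -> alpha * z ^+ 2 <= 4 / N -> z <= theta / 2.
Proof.
move=> a0 au z0 az; rewrite leNgt; apply/negP => tz.
have u0 : 0 < n * theta by exact: lt_trans theta8.
have t0 : 0 < theta by rewrite -(pmulr_rgt0 _ n0).
have H1 : alpha * (n * z) ^+ 2 <= 16.
  have : n ^+ 2 * (alpha * z ^+ 2) <= n ^+ 2 * (4 / N) by rewrite ler_wpM2l ?sqr_ge0.
  rewrite (_ : n ^+ 2 * (4 / N) = 4 * (n ^+ 2 / N)); last by ring.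
  rewrite (_ : n ^+ 2 * (alpha * z ^+ 2) = alpha * (n * z) ^+ 2); last by ring.
  by move=> /le_trans; apply; have := r4; lra.
have H2 : (n * theta) / 2 <= n * z by rewrite -mulrA ler_pM2l// ltW.
have H3 : alpha * (n * theta) * (n * theta) <= 4 * (alpha * (n * z) ^+ 2).
  have : ((n * theta) / 2) ^+ 2 <= (n * z) ^+ 2.
    by rewrite lerXn2r ?nnegrE ?(mulr_ge0 (ltW n0) z0)// divr_ge0// ltW.
  move=> /(ler_wpM2l (ltW a0)).
  rewrite (_ : alpha * (n * theta / 2) ^+ 2 =
    alpha * (n * theta) * (n * theta) / 4); last by field.
  by lra.
have : 8 * 8 < alpha * (n * theta) * (n * theta) by rewrite ltr_pM.
by lra.
Qed.

(** With u = n theta and n^2 <= 4 N, multiplying by n^2 turns the hypothesis into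
    p u^2 / 4 <= 32 u + 256; dividing by u > 8 gives p u <= 256. *)
Lemma chebyshev_ratio_le (p : R) :
  p * (theta / 2) ^+ 2 <= 8 * n * theta / N + 8 * n * (n + 1) / N ^+ 2 ->
  p * (n * theta) <= 256.
Proof.
move=> Hp; have u0 : 0 < n * theta by exact: lt_trans theta8.
have {Hp} : n ^+ 2 * (p * (theta / 2) ^+ 2) <=
    n ^+ 2 * (8 * n * theta / N + 8 * n * (n + 1) / N ^+ 2).
  by rewrite ler_wpM2l ?sqr_ge0.
rewrite (_ : n ^+ 2 * (p * _) = p * (n * theta) * (n * theta) / 4); last by field.
rewrite (_ : n ^+ 2 * _ = 8 * (n ^+ 2 / N) * (n * theta) +
    8 * (n ^+ 2 / N) ^+ 2 * (1 + n^-1)); last first.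
  by field; rewrite !gt_eqF.
have [[u8 s0] s4] := (theta8, r0, r4).
set u := n * theta in u0 u8 *; set r := n ^+ 2 / N in s0 s4 * => H.
have H1 : r * u <= 4 * u by rewrite ler_pM2r.
have H2 : r ^+ 2 * (1 + n^-1) <= 16 * 2.
  rewrite ler_pM ?sqr_ge0 ?addr_ge0 ?invr_ge0 ?(ltW n0)//.
    by rewrite (_ : 16 = 4 ^+ 2); [rewrite lerXn2r ?nnegrE|ring].
  by rewrite -[leRHS]/(1 + 1) lerD2l invf_le1.
rewrite -(ler_pM2r u0); lra.
Qed.

End rate_arithmetic.

(** * The test statistic *)

Section gauss_facts.
Context {R : realType}.

Lemma measurable_tnth_comp {d : measure_display} {T : measurableType d}
    {m : nat} (u : T -> m.-tuple R) (i : 'I_m) :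
  measurable_fun [set: T]%classic u ->
  measurable_fun [set: T]%classic (fun x => tnth (u x) i).
Proof. by move=> /measurable_fun_tnthP mu; exact: mu. Qed.

Lemma measurable_cat_tuple {d : measure_display} {T : measurableType d} {m n : nat}
    (u : T -> m.-tuple R) (v : T -> n.-tuple R) :
  measurable_fun [set: T]%classic u -> measurable_fun [set: T]%classic v ->
  measurable_fun [set: T]%classic (fun x => [tuple of u x ++ v x]).
Proof.
move=> mu mv; apply/measurable_fun_tnthP => i.
case: (split_ordP i) => j ->.
  rewrite (_ : _ \o _ = fun x => tnth (u x) j); last first.
    by apply/funext => x; rewrite /= tnth_lshift.
  exact: measurable_tnth_comp.
rewrite (_ : _ \o _ = fun x => tnth (v x) j); last first.
  by apply/funext => x; rewrite /= tnth_rshift.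
exact: measurable_tnth_comp.
Qed.

Lemma gaussC {m : nat} (sigma : R) (v w : m.-tuple R) :
  gauss sigma v w = gauss sigma w v.
Proof.
rewrite /gauss (_ : sqdist v w = sqdist w v)//.
by apply: eq_bigr => i _; rewrite -sqrrN opprB.
Qed.

Lemma gauss_itv {m : nat} (sigma : R) (v w : m.-tuple R) :
  0 <= gauss sigma v w <= 1.
Proof.
rewrite expR_ge0 -expR0 ler_expR oppr_le0 divr_ge0// mulr_ge0 ?sqr_ge0//.
by apply: sumr_ge0 => i _; exact: sqr_ge0.
Qed.

Lemma bounded_mfun_gauss {d : measure_display} {T : measurableType d} {m : nat}
    (sigma : R) (u u' : T -> m.-tuple R) :
  measurable_fun [set: T]%classic u -> measurable_fun [set: T]%classic u' ->
  bounded_mfun (fun x => gauss sigma (u x) (u' x)).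
Proof.
move=> mu mu'; split; last first.
  by exists 1 => x; have /andP[g0 g1] := gauss_itv sigma (u x) (u' x); rewrite ger0_norm.
apply: measurableT_comp; first exact: measurable_expR.
apply: measurable_funN.
apply: measurable_funM => //; apply: measurable_funM => //.
apply: measurable_sum => i; apply: measurable_funX; apply: measurable_funB.
  exact: measurable_tnth_comp.
exact: measurable_tnth_comp.
Qed.

End gauss_facts.

Section test_statistic.
Context {R : realType} {dX dY dZ : nat}.
Variable sigma : R.
Local Notation W := (augmented R dX dY dZ).

Definition contrast (w1 w2 : W) : R :=
  gauss sigma (vec w1) (vec w2) + gauss sigma (vec' w1) (vec' w2)
  - gauss sigma (vec w1) (vec' w2) - gauss sigma (vec' w1) (vec w2).

Lemma contrastC w1 w2 : contrast w1 w2 = contrast w2 w1.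
Proof.
rewrite /contrast (gaussC _ (vec w1)) (gaussC _ (vec' w1)).
by rewrite (gaussC _ (vec w1)) (gaussC _ (vec' w1)); ring.
Qed.

Lemma psd_contrast : psd_kernel contrast.
Proof. by apply: psd_kernel_contrast; exact: psd_gauss. Qed.

Lemma contrast_le w1 w2 : `|contrast w1 w2| <= 2.
Proof.
rewrite /contrast; do 4!
  match goal with |- context [gauss sigma ?v ?w] =>
    have /andP[] := gauss_itv sigma v w; move: (gauss sigma v w) => ? ? ? end.
by rewrite ler_norml; apply/andP; split; lra.
Qed.

(** Exchanging X and X' exchanges [vec] and [vec'], which negates one factor of the
    inner product. *)
Lemma contrast_swap (b c : bool) w1 w2 :
  contrast (swap b w1) (swap c w2) = rsign b * rsign c * contrast w1 w2.
Proof.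
case: w1 => [[[x1 y1] z1] x1']; case: w2 => [[[x2 y2] z2] x2'].
by rewrite /contrast /rsign; case: b; case: c => /=; ring.
Qed.

Lemma measurable_vec : measurable_fun [set: W]%classic vec.
Proof.
rewrite (_ : vec = fun w : W => [tuple of [tuple of w.1.1.1 ++ w.1.1.2] ++ w.1.2]).
  apply: measurable_cat_tuple; first apply: measurable_cat_tuple.
  - by do 2! apply: measurableT_comp => //; exact: measurable_fst.
  - by apply: measurableT_comp => //; apply: measurableT_comp => //.
  - by apply: measurableT_comp => //.
by apply/funext => -[[[x y] z] x'].
Qed.

Lemma measurable_vec' : measurable_fun [set: W]%classic vec'.
Proof.
rewrite (_ : vec' = fun w : W => [tuple of [tuple of w.2 ++ w.1.1.2] ++ w.1.2]).
  apply: measurable_cat_tuple; first apply: measurable_cat_tuple.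
  - by [].
  - by apply: measurableT_comp => //; apply: measurableT_comp => //.
  - by apply: measurableT_comp => //.
by apply/funext => -[[[x y] z] x'].
Qed.

Let bgauss (u u' : W -> (dX + dY + dZ).-tuple R) :
  measurable_fun [set: W]%classic u -> measurable_fun [set: W]%classic u' ->
  bounded_mfun (fun w : W * W => gauss sigma (u w.1) (u' w.2)).
Proof.
by move=> mu mu'; apply: bounded_mfun_gauss; apply: measurableT_comp.
Qed.

Lemma bounded_mfun_contrast : bounded_mfun (fun w : W * W => contrast w.1 w.2).
Proof.
have [mv mv'] := (measurable_vec, measurable_vec').
by apply: bounded_mfunB; [apply: bounded_mfunB; [apply: bounded_mfunD|]|];
  exact: bgauss.
Qed.

Lemma zeta_hatE n (D : n.-tuple W) :
  zeta_hat sigma D = 'C(n, 2)%:R^-1 * pair_sum contrast D.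
Proof. by []. Qed.

Lemma zeta_hat_permE n s (D : n.-tuple W) :
  zeta_hat_perm sigma s D = 'C(n, 2)%:R^-1 *
    \sum_(i < n) \sum_(j < n | (i < j)%N)
      rsign (s i) * rsign (s j) * contrast (tnth D i) (tnth D j).
Proof.
rewrite /zeta_hat_perm zeta_hatE; congr (_ * _).
apply: eq_bigr => i _; apply: eq_bigr => j _.
by rewrite !tnth_mktuple contrast_swap.
Qed.

(** The two cross terms of the contrast have the same mean, since the kernel is
    symmetric and the two observations are exchangeable. *)
Lemma expect_contrast (Q : probability W R) :
  ('E_(Q \x Q)[fun w => gauss sigma (vec w.1) (vec w.2)]
   + 'E_(Q \x Q)[fun w => gauss sigma (vec' w.1) (vec' w.2)]
   - 2%:E * 'E_(Q \x Q)[fun w => gauss sigma (vec w.1) (vec' w.2)])%E =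
  (\int[(Q \x Q)%E]_w contrast w.1 w.2)%:E.
Proof.
have [mv mv'] := (measurable_vec, measurable_vec').
have EE (f : W * W -> R) : bounded_mfun f ->
    ('E_(Q \x Q)[f] = (\int[(Q \x Q)%E]_w f w)%:E)%E.
  move=> bf; rewrite unlock fineK//; apply: integrable_fin_num => //.
  exact: (@bounded_mfun_integrable _ _ _ (Q \x Q)%E).
have sym : \int[(Q \x Q)%E]_w gauss sigma (vec' w.1) (vec w.2) =
    \int[(Q \x Q)%E]_w gauss sigma (vec w.1) (vec' w.2).
  rewrite expect_fubini12; last exact: bgauss.
  rewrite expect_fubini21; last exact: bgauss.
  by apply: eq_Rintegral => x _; apply: eq_Rintegral => y _; exact: gaussC.
rewrite !EE; [|exact: bgauss..].
rewrite -EFinD; congr (_%:E).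
rewrite /contrast (@expectB _ _ _ (Q \x Q)%E); last 2 first.
- by apply: bounded_mfunB; [apply: bounded_mfunD|]; exact: bgauss.
- exact: bgauss.
rewrite (@expectB _ _ _ (Q \x Q)%E); last 2 first.
- by apply: bounded_mfunD; exact: bgauss.
- exact: bgauss.
rewrite (@expectD _ _ _ (Q \x Q)%E); [|exact: bgauss..].
rewrite sym; move: (Rintegral _ _ _) => x; move: (Rintegral _ _ _) => y.
by move: (Rintegral _ _ _) => z; ring.
Qed.

Lemma zetaE (F : probability (triple R dX dY dZ) R)
    (k : R.-pker dZ.-tuple R ~> dX.-tuple R) :
  zeta sigma F k =
  (\int[(extend_law F k \x extend_law F k)%E]_w contrast w.1 w.2)%:E.
Proof. exact: (expect_contrast (extend_law F k)). Qed.

Variable alpha : R.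
Hypothesis alpha01 : 0 < alpha < 1.

Let sign_weights n : (2 ^+ n)^-1 * #|{: {ffun 'I_n -> bool}}|%:R = 1 :> R.
Proof.
by rewrite card_ffun card_bool card_ord natrX mulVf// expf_neq0// pnatr_eq0.
Qed.

Lemma zeta_hat_le_crit n (D : n.-tuple W) :
  (zeta_hat sigma D <= crit_value sigma alpha D) =
  ((2 ^+ n)^-1 * (\sum_(s : {ffun 'I_n -> bool})
     ((zeta_hat_perm sigma s D < zeta_hat sigma D)%R : nat)%:R) < 1 - alpha).
Proof.
have /andP[a0 a1] := alpha01.
apply: le_empirical_quantile; rewrite ?subr_gt0 ?invr_gt0 ?exprn_gt0//.
by rewrite sign_weights gerBl ltW.
Qed.

(** The bound on the critical value is uniform in the data: conditionally on them,
    the resampled statistics have mean square N^-2 times a sum of N squared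
    contrasts, each at most 4. *)
Lemma zeta_hat_le_crit_sqr n (D : n.-tuple W) :
  (1 < n)%N -> zeta_hat sigma D <= crit_value sigma alpha D ->
  0 < zeta_hat sigma D -> alpha * zeta_hat sigma D ^+ 2 <= 4 / 'C(n, 2)%:R.
Proof.
move=> n1 zc z0; have /andP[a0 a1] := alpha01.
have N0 : 0 < 'C(n, 2)%:R :> R by rewrite ltr0n bin_gt0.
have w0 : 0 < (2 ^+ n)^-1 :> R by rewrite invr_gt0 exprn_gt0.
have q0 : 0 < 1 - alpha by rewrite subr_gt0.
have q1 : 1 - alpha <= (2 ^+ n)^-1 * #|{: {ffun 'I_n -> bool}}|%:R.
  by rewrite sign_weights gerBl ltW.
have := empirical_quantile_sqr w0 q0 q1 (sign_weights n) z0 zc.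
rewrite opprB addrC subrK => /le_trans; apply.
under eq_bigr do rewrite zeta_hat_permE exprMn.
rewrite -mulr_sumr sum_sqr_rademacher_chaos mulrCA mulKf ?gt_eqF ?exprn_gt0//.
apply: (@le_trans _ _ ('C(n, 2)%:R^-1 ^+ 2 * (4 * 'C(n, 2)%:R))).
  rewrite ler_wpM2l ?sqr_ge0// -sum_ltn_pairs mulr_sumr.
  apply: ler_sum => i _; rewrite mulr_sumr; apply: ler_sum => j _.
  have := contrast_le (tnth D i) (tnth D j); rewrite ler_norml => /andP[? ?].
  by nra.
by rewrite le_eqVlt; apply/orP; left; apply/eqP; field; rewrite gt_eqF.
Qed.

Lemma bounded_mfun_zeta_hat n : bounded_mfun (@zeta_hat R dX dY dZ sigma n).
Proof.
apply: bounded_mfunZ.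
exact: (bounded_mfun_pair_sum contrast_le bounded_mfun_contrast.1).
Qed.

Lemma mean_square_zeta_hat (Q : probability W R) n
    (theta := \int[(Q \x Q)%E]_w contrast w.1 w.2) : (1 < n)%N ->
  \int[iid_law Q n]_D (zeta_hat sigma D - theta) ^+ 2 <=
  8 * n%:R * theta / 'C(n, 2)%:R + 8 * n%:R * (n%:R + 1) / 'C(n, 2)%:R ^+ 2.
Proof.
move=> n1; have N0 : 0 < 'C(n, 2)%:R :> R by rewrite ltr0n bin_gt0.
have mc := bounded_mfun_contrast.1; have two0 : 0 < 2 :> R by [].
have bS : bounded_mfun (@pair_sum W R contrast n).
  exact: (bounded_mfun_pair_sum contrast_le mc).
have := variance_pair_sum Q contrastC psd_contrast two0 contrast_le mc n.
have := expect_pair_sum Q contrast_le mc n; rewrite -/theta.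
rewrite expect_sqrB; last exact: bounded_mfun_zeta_hat.
have -> : \int[iid_law Q n]_D zeta_hat sigma D =
    'C(n, 2)%:R^-1 * \int[iid_law Q n]_D pair_sum contrast D by rewrite -expectZ.
have -> : \int[iid_law Q n]_D zeta_hat sigma D ^+ 2 =
    'C(n, 2)%:R^-1 ^+ 2 * \int[iid_law Q n]_D pair_sum contrast D ^+ 2.
  rewrite -expectZ; last exact: bounded_mfunX.
  by apply: eq_Rintegral => D _; rewrite zeta_hatE exprMn.
move=> ->; set V := \int[_]_D _; set N := 'C(n, 2)%:R in N0 *; move=> HV.
have {HV} : N^-1 ^+ 2 * (V - (N * theta) ^+ 2) <= N^-1 ^+ 2 *
    (4 * 2 * n%:R * (N * theta) + 2 * 2 ^+ 2 * n%:R * (n%:R + 1)).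
  by rewrite ler_wpM2l// sqr_ge0.
by congr (_ <= _); field; rewrite gt_eqF.
Qed.

Lemma measurable_acceptance n : measurable
  [set D : n.-tuple W | zeta_hat sigma D <= crit_value sigma alpha D]%classic.
Proof.
have bh (i j : 'I_n) :
    bounded_mfun (fun D : n.-tuple W => contrast (tnth D i) (tnth D j)).
  apply: (bounded_mfun_comp (u := fun D : n.-tuple W => (tnth D i, tnth D j))
    _ bounded_mfun_contrast).
  by apply: measurable_fun_pair; exact: measurable_tnth.
have [mz _] := bounded_mfun_zeta_hat n.
have mp s : measurable_fun [set: n.-tuple W]%classic (zeta_hat_perm sigma s).
  suff [mb _] : bounded_mfun (@zeta_hat_perm R dX dY dZ sigma n s) by exact: mb.
  rewrite (_ : zeta_hat_perm sigma s = fun D => 'C(n, 2)%:R^-1 *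
      \sum_(i < n) \sum_(j < n | (i < j)%N)
        rsign (s i) * rsign (s j) * contrast (tnth D i) (tnth D j)); last first.
    by apply/funext => D; exact: zeta_hat_permE.
  apply: bounded_mfunZ; do 2! apply: bounded_mfun_sum => ? _.
  by apply: bounded_mfunZ; exact: bh.
under eq_set do rewrite zeta_hat_le_crit.
rewrite -[X in measurable X]setTI; apply: measurable_fun_ltr => //.
apply: measurable_funM => //; apply: measurable_sum => s.
rewrite (_ : (fun D => _) = fun D : n.-tuple W =>
    if zeta_hat_perm sigma s D < zeta_hat sigma D then 1 else 0).
  by apply: measurable_fun_ifT => //; exact: measurable_fun_ltr.
by apply/funext => D; case: ifP.
Qed.

(** Acceptance brings the statistic below theta / 2, where the squared deviation
    from the mean theta is at least (theta / 2)^2; integrating this pointwise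
    comparison is Chebyshev's inequality. *)
Lemma acceptance_prob_le (Q : probability W R) n (beta c : R) :
  0 < beta -> 256 / beta + 8 / alpha < c -> (1 < n)%N ->
  c * n%:R^-1 < \int[(Q \x Q)%E]_w contrast w.1 w.2 ->
  (iid_law Q n
    [set D | (zeta_hat sigma D <= crit_value sigma alpha D)%R]%classic <= beta%:E)%E.
Proof.
move=> be0 cC n1; have /andP[a0 a1] := alpha01.
set theta := \int[_]_w _ => ctheta.
have n0 : 0 < n%:R :> R by rewrite ltr0n ltnW.
have nR1 : 1 <= n%:R :> R by rewrite ler1n ltnW.
have uc : c < n%:R * theta by rewrite mulrC -ltr_pdivrMr.
have ube : 256 < beta * (n%:R * theta).
  rewrite mulrC -ltr_pdivrMr//; apply: lt_trans uc; apply: le_lt_trans cC.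
  by rewrite lerDl divr_ge0// ltW.
have ual : 8 < alpha * (n%:R * theta).
  rewrite mulrC -ltr_pdivrMr//; apply: lt_trans uc; apply: le_lt_trans cC.
  by rewrite lerDr divr_ge0// ltW.
have u8 : 8 < n%:R * theta.
  have u0 : 0 < n%:R * theta by rewrite -(pmulr_rgt0 _ a0) (lt_trans _ ual).
  by apply: (lt_trans ual); rewrite gtr_pMl.
have theta0 : 0 < theta by rewrite -(pmulr_rgt0 _ n0) (lt_trans _ u8).
have N4 : n%:R ^+ 2 <= 4 * 'C(n, 2)%:R :> R.
  by rewrite -natrX -natrM ler_nat sqr_le_bin2.
have N0 : 0 < 'C(n, 2)%:R :> R by rewrite ltr0n bin_gt0.
set A := [set D | _]%classic.
have mA : measurable A by exact: measurable_acceptance.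
have zA D : A D -> zeta_hat sigma D <= theta / 2.
  move=> AD; have [z0|z0] := ltP 0 (zeta_hat sigma D); last first.
    by apply: (le_trans z0); rewrite divr_ge0// ltW.
  apply: (threshold_le_half_signal nR1 N0 N4 u8 a0 ual (ltW z0)).
  exact: zeta_hat_le_crit_sqr.
have bA : bounded_mfun (\1_A : n.-tuple W -> R).
  split; first exact: measurable_indic.
  by exists 1 => D; rewrite indicE; case: (_ \in _); rewrite ?normr1// normr0.
have PA : iid_law Q n A = (\int[iid_law Q n]_D \1_A D)%:E.
  rewrite fineK; first by rewrite integral_indic// setIT.
  apply: integrable_fin_num => //.
  exact: (@bounded_mfun_integrable _ _ _ (iid_law Q n)).
rewrite PA lee_fin.
have ms : (\int[iid_law Q n]_D \1_A D) * (theta / 2) ^+ 2 <=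
    8 * n%:R * theta / 'C(n, 2)%:R + 8 * n%:R * (n%:R + 1) / 'C(n, 2)%:R ^+ 2.
  apply: le_trans (mean_square_zeta_hat Q n1); rewrite -/theta mulrC -expectZ//.
  apply: le_expect; first exact: bounded_mfunZ.
    apply: bounded_mfunX; apply: bounded_mfunB; first exact: bounded_mfun_zeta_hat.
    exact: bounded_mfun_cst.
  move=> D; rewrite indicE; have [/set_mem/zA zD|_] := boolP (D \in A).
    rewrite mulr1 -[leRHS]sqrrN opprB lerXn2r ?nnegrE.
    - by [].
    - by rewrite divr_ge0// ltW.
    - by rewrite subr_ge0 (le_trans zD)// ler_piMr ?invf_le1 ?ler1n// ltW.
    - by rewrite lerBrDl -lerBrDr (le_trans zD)//; lra.
  by rewrite mulr0 sqr_ge0.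
have u0 : 0 < n%:R * theta by exact: lt_trans u8.
rewrite -(ler_pM2r u0) (le_trans _ (ltW ube))//.
exact: (chebyshev_ratio_le nR1 N0 N4 u8 ms).
Qed.

Lemma type2_error_le (F : probability (triple R dX dY dZ) R)
    (k : R.-pker dZ.-tuple R ~> dX.-tuple R) n (beta c : R) :
  0 < beta -> 256 / beta + 8 / alpha < c -> (1 < n)%N ->
  ((c * n%:R^-1)%:E < zeta sigma F k)%E ->
  (type2_error sigma alpha n F k <= beta%:E)%E.
Proof.
move=> be0 cC n1; rewrite zetaE lte_fin => cz.
exact: (acceptance_prob_le be0 cC n1 cz).
Qed.

End test_statistic.

Theorem theorem3p4 (R : realType) (alpha : R) (halpha : 0 < alpha < 1)
    (beta : R) (hbeta : 0 < beta < 1 - alpha) :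
  exists C0 : R,
    forall (sigma : R) (hsigma : 0 < sigma ^+ 2) (dX dY dZ : nat) (c : R),
      C0 < c ->
      (limn_esup (fun n : nat =>
         max_type2_error dX dY dZ sigma alpha n (c * n%:R^-1)%R)
       <= beta%:E)%E.
Proof.
have /andP[a0 a1] := halpha; have /andP[be0 be1] := hbeta.
exists (256 / beta + 8 / alpha) => sigma _ dX dY dZ c cC.
rewrite /limn_esup limf_esupE.
(* The bound holds for every n > 1, so the tail from 2 on already witnesses it. *)
apply: (@le_trans _ _ (ereal_sup [set max_type2_error dX dY dZ sigma alpha n
    (c * n%:R^-1)%R | n in [set n | (1 < n)%N]]%classic)).
  by apply: ereal_inf_lbound => /=; exists [set n | (1 < n)%N]%classic => //;
    exact: nbhs_infty_gt.
apply: ge_ereal_sup => _ [n /= n1 <-].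
apply: ge_ereal_sup => _ [F [k [_ cz ->]]].
exact: type2_error_le cz.
Qed.
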